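(* If $S\in\Delta^2_n$, then $$E(S)=\frac{1}{\pi}\int_{-\infty}^{\infty}\frac{1}{z^2}\log\Big|1+\sum_{j=1}^{\lfloor n/2\rfloor}(-1)^j c_{2j}(S)\,z^{2j}\Big|\,dz .$$
   Context: A sidigraph is a digraph (no loops, at most one arc from $u$ to $v$) with a sign $\sigma(a)\in\{-1,1\}$ on each arc; its adjacency matrix $A(S)$ has entry $\sigma(v_i,v_j)$ if there is an arc from $v_i$ to $v_j$ and $0$ otherwise, and $\phi_S(z)=\det(zI-A(S))$. The energy of a sidigraph $S$ with eigenvalues $z_1,\dots,z_n$ is $E(S)=\sum_{j=1}^n|\Re z_j|$. The sign of a directed cycle is the product of its arc signs. $\Delta^2_n$ is the class of sidigraphs on $n$ vertices whose underlying digraph is bipartite and in which every directed cycle is negative. $c_{2j}(S)$ is the number of linear subsidigraphs of $S$ of order $2j$ (subsidigraphs on $2j$ vertices in which every vertex has indegree and outdegree $1$); for $S\in\Delta^2_n$ one has $\phi_S(z)=z^n+\sum_{j=1}^{\lfloor n/2\rfloor}c_{2j}(S)z^{n-2j}$. The integral is understood as a principal value. *)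

(* Defs.v *)
From Stdlib Require Import Reals List.
From HB Require Import structures.
From mathcomp Require Import all_boot all_order all_algebra.

Set Implicit Arguments.
Unset Strict Implicit.
Unset Printing Implicit Defensive.

(* A sidigraph on vertex set 'I_n is encoded by its adjacency matrix
   A : 'M[int]_n with entries in {-1,0,1} and zero diagonal (no loops);
   there is an arc i -> j iff A i j != 0, and its sign is A i j. *)
Definition is_sidigraph (n : nat) (A : 'M[int]_n) : Prop :=
  (forall i j : 'I_n, A i j = 0%R \/ A i j = 1%R \/ A i j = (-1)%R) /\
  (forall i : 'I_n, A i i = 0%R).

Definition arc (n : nat) (A : 'M[int]_n) : rel 'I_n := fun i j => A i j != 0%R.

Definition bipartite_underlying (n : nat) (A : 'M[int]_n) : Prop :=
  exists col : 'I_n -> bool, forall i j : 'I_n, arc A i j -> col i != col j.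

Definition is_dicycle (n : nat) (A : 'M[int]_n) (s : seq 'I_n) : bool :=
  [&& s != [::], uniq s & cycle (arc A) s].

Definition cycle_sign (n : nat) (A : 'M[int]_n) (s : seq 'I_n) : int :=
  (\prod_(p <- zip s (rot 1 s)) A p.1 p.2)%R.

Definition all_cycles_negative (n : nat) (A : 'M[int]_n) : Prop :=
  forall s : seq 'I_n, is_dicycle A s -> cycle_sign A s = (-1)%R.

Definition in_Delta2 (n : nat) (A : 'M[int]_n) : Prop :=
  is_sidigraph A /\ bipartite_underlying A /\ all_cycles_negative A.

(* A linear subsidigraph is given by its arc set X (a set of arcs of S);
   its vertex set is the set of endpoints of arcs in X, and every vertex of
   it has indegree and outdegree exactly 1 in X. *)
Definition lsd_vertices (n : nat) (X : {set 'I_n * 'I_n}) : {set 'I_n} :=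
  [set v | [exists p in X, (p.1 == v) || (p.2 == v)]].

Definition is_linear_subsidigraph (n : nat) (A : 'M[int]_n)
    (X : {set 'I_n * 'I_n}) : bool :=
  [forall p in X, arc A p.1 p.2] &&
  [forall v in lsd_vertices X,
     (#|[set p in X | p.1 == v]| == 1%N) && (#|[set p in X | p.2 == v]| == 1%N)].

Definition c_lin (n : nat) (A : 'M[int]_n) (k : nat) : nat :=
  #|[set X : {set 'I_n * 'I_n} |
      is_linear_subsidigraph A X && (#|lsd_vertices X| == k)]|.

Local Open Scope R_scope.

Definition Cx : Type := (R * R)%type.
Definition Cadd (z w : Cx) : Cx := (fst z + fst w, snd z + snd w).
Definition Csub (z w : Cx) : Cx := (fst z - fst w, snd z - snd w).
Definition Cmul (z w : Cx) : Cx :=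
  (fst z * fst w - snd z * snd w, fst z * snd w + snd z * fst w).
Definition RtoC (x : R) : Cx := (x, 0).

Definition int_to_R (z : int) : R :=
  match z with
  | Posz k => INR k
  | Negz k => - INR (S k)
  end.

Definition Cpoly_eval (p : {poly int}) (w : Cx) : Cx :=
  foldr (fun c acc => Cadd (RtoC (int_to_R c)) (Cmul w acc)) (RtoC 0) (polyseq p).

Definition phi (n : nat) (A : 'M[int]_n) : {poly int} := char_poly A.

Definition eigenvalue_list (n : nat) (A : 'M[int]_n) (zs : seq Cx) : Prop :=
  size zs = n /\
  forall w : Cx, Cpoly_eval (phi A) w = foldr (fun z acc => Cmul (Csub w z) acc) (RtoC 1) zs.

Definition energy (zs : seq Cx) : R := foldr (fun z acc => Rabs (fst z) + acc) 0 zs.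

Definition Rint (f : R -> R) (a b v : R) : Prop :=
  exists pr : Riemann_integrable f a b, RiemannInt pr = v.

Fixpoint pv_pieces (a : R) (pts : seq R) (eps Rb : R) : seq (R * R) :=
  match pts with
  | nil => (a, Rb) :: nil
  | p :: ps => (a, p - eps) :: pv_pieces (p + eps) ps eps Rb
  end.

Fixpoint pieces_int (f : R -> R) (l : seq (R * R)) (v : R) : Prop :=
  match l with
  | nil => v = 0
  | (a, b) :: l' => exists v1 v2, Rint f a b v1 /\ pieces_int f l' v2 /\ v = v1 + v2
  end.

Definition Rltb (x y : R) : bool := if Rlt_dec x y then true else false.

(* PV_integral f I : the principal-value integral of f over (-oo, oo) equals I:
   for some finite strictly increasing list of exceptional points, f is
   Riemann integrable on the truncated domain [-Rb,Rb] minus the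
   eps-neighbourhoods of these points, and these integrals tend to I as
   eps -> 0+ and Rb -> +oo. *)
Definition PV_integral (f : R -> R) (I : R) : Prop :=
  exists pts : seq R,
    sorted Rltb pts /\
    forall e, 0 < e -> exists delta R0, 0 < delta /\
      forall eps Rb, 0 < eps < delta -> R0 < Rb ->
        exists v, pieces_int f (pv_pieces (- Rb) pts eps Rb) v /\ Rabs (v - I) < e.

Definition coulson_integrand (n : nat) (A : 'M[int]_n) (z : R) : R :=
  / (z ^ 2) * ln (Rabs (1 + fold_right Rplus 0
     (List.map (fun j => (-1) ^ j * INR (c_lin A (2 * j)%N) * z ^ (2 * j))
        (iota 1 (n./2))))).

(* Main.v *)
From Coquelicot Require Import Coquelicot.
From Stdlib Require Import Reals Lra.
From HB Require Import structures.
From mathcomp Require Import all_boot all_order all_algebra all_fingroup.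
Require Import Defs.

Set Implicit Arguments.
Unset Strict Implicit.
Unset Printing Implicit Defensive.

(** The determinant expansion of [det (zI - A)] runs over permutations; since
    every directed cycle is negative, each permutation moving its points along
    arcs contributes [+1], so the coefficient of [z^(n-k)] is [c_k], and [c_k]
    vanishes for odd [k] by bipartiteness.  Evaluating at [i/z] gives
    [P(z)^2 = prod_k Q_k(z)], where [P] is the polynomial under the logarithm and
    [Q_k(z) = (1 - y z)^2 + (x z)^2] for the eigenvalue [x + i y].

    Hence the integrand is the sum over the eigenvalues of [ln Q_k(z) / (2 z^2)],
    which has the elementary primitive
    [F(z) = y/2 (ln Q_k - ln z^2) - ln Q_k / (2 z) + |x| atan (((x^2+y^2) z - y) / |x|)].
    At every point [p], also at [0] and at the real zeros of [Q_k], the symmetric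
    jump [F(p+e) - F(p-e)] tends to [0], and [F(r) - F(-r)] tends to [PI |x|] as
    [r] tends to infinity. *)

(** * The coefficients of the characteristic polynomial *)

Section Sachs.

Import GRing.Theory.
Local Open Scope ring_scope.

Variables (n : nat) (A : 'M[int]_n).
Implicit Types (s : 'S_n) (X : {set 'I_n * 'I_n}).

Definition moved s : {set 'I_n} := [set i | s i != i].

Definition arcs_of s : {set 'I_n * 'I_n} := [set p | (p.2 == s p.1) && (p.1 != p.2)].

Definition moves_along_arcs s : bool := [forall i in moved s, arc A i (s i)].

Lemma rot1_traject (T : Type) (f : T -> T) (x : T) m :
  iter m.+1 f x = x -> rot 1 (traject f x m.+1) = map f (traject f x m.+1).
Proof.
have map_traject y k : map f (traject f y k) = traject f (f y) k.
  by elim: k y => //= k IH y; rewrite IH.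
move=> fx; rewrite map_traject [RHS]trajectSr -iterSr fx /= rot1_cons //.
Qed.

Lemma cycle_sign_porbit s x :
  cycle_sign A (traject s x #|porbit s x|) = \prod_(i in porbit s x) A i (s i).
Proof.
rewrite /cycle_sign (eq_bigl _ _ (porbit_traject s x)).
rewrite -[RHS](big_uniq _ (uniq_traject_porbit s x)) /=.
have := card_porbit_neq0 s x; have := iter_porbit s x.
case: #|porbit s x| => // m fx _; rewrite rot1_traject //.
have -> (t : seq 'I_n) : zip t (map s t) = [seq (i, s i) | i <- t].
  by elim: t => //= i t ->.
by rewrite big_map.
Qed.

Lemma dicycle_porbit s x :
  moves_along_arcs s -> s x != x -> is_dicycle A (traject s x #|porbit s x|).
Proof.
move=> /forall_inP sA sx; have := porbit_traject s x.
have := uniq_traject_porbit s x; have := iter_porbit s x.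
have := card_porbit_neq0 s x; rewrite /is_dicycle.
case: #|porbit s x| => // m _ fx -> memx; rewrite /=.
have: path (frel s) x (rcons (traject s (s x) m) x).
  have := fpath_traject s x m.+1.
  by rewrite trajectSr -iterSr fx.
apply: (@sub_in_path _ (mem (porbit s x))); last first.
  apply/allP => i; rewrite inE mem_rcons inE orbA orbb -[_ || _]/(i \in traject s x m.+1).
  by rewrite -memx.
move=> i j xi _ /= /eqP <-; apply: sA; rewrite inE.
apply: contra sx => /eqP si.
have: x \in porbit s i by rewrite porbit_sym.
case/porbitP => k ->; suff -> : (s ^+ k)%g i = i by rewrite si.
by elim: k => [|k IH]; rewrite ?expg0 ?perm1 // expgS permM si.
Qed.

Lemma porbit_fixed s x : s x = x -> porbit s x = [set x].
Proof.
move=> sx; apply/setP => y; rewrite inE; apply/porbitP/eqP.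
  by case=> k ->; elim: k => [|k IH]; rewrite ?expg0 ?perm1 // expgS permM sx.
by move=> ->; exists 0%N; rewrite expg0 perm1.
Qed.

Lemma moved_porbit s x y : y \in porbit s x -> (s y == y) = (s x == x).
Proof.
move=> xy; apply/eqP/eqP => [sy|sx].
  by move: xy; rewrite porbit_sym porbit_fixed // inE => /eqP ->.
by move: xy; rewrite porbit_fixed // inE => /eqP ->.
Qed.

Hypothesis negA : all_cycles_negative A.

(* A cycle of length l >= 2 contributes (-1)^l from the factors -A i (s i) and
   -1 from its sign, a fixed point contributes 1: both are (-1)^(l+1). *)
Lemma prod_perm_entries s : moves_along_arcs s ->
  \prod_i (if s i == i then 1 else - A i (s i)) = (-1) ^+ s.
Proof.
move=> sA; rewrite (partition_big_imset (porbit s)) /= -/(porbits s).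
(* The parity of [s] is that of [n] plus the number of orbits, and [n] is the sum of the orbit
   sizes. *)
have -> : (-1 : int) ^+ s = \prod_(C in porbits s) (-1) ^+ (#|C| + 1)%N.
  rewrite prodrXr big_split /= sum1_card.
  have -> : \sum_(C in porbits s) #|C| = n.
    rewrite -[RHS]card_ord -sum1_card (partition_big_imset (porbit s)) /=.
    apply: eq_bigr => _ /imsetP [x _ ->]; rewrite -sum1_card.
    by apply: eq_bigl => y; rewrite eq_porbit_mem.
  by rewrite /odd_perm card_ord -oddD signr_odd.
apply: eq_bigr => _ /imsetP [x _ ->].
rewrite (eq_bigl (mem (porbit s x))); last by move=> y; rewrite eq_porbit_mem.
have [sx|sx] := eqVneq (s x) x.
  rewrite porbit_fixed // cards1 big1 // => y /=; rewrite in_set1 => /eqP ->.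
  by rewrite sx eqxx.
rewrite (eq_bigr (fun i => - A i (s i))); last first.
  by move=> y xy; rewrite (moved_porbit xy) (negbTE sx).
rewrite prodrN -cycle_sign_porbit negA ?dicycle_porbit //.
by rewrite exprD expr1.
Qed.

Hypothesis sidA : is_sidigraph A.

(** In the Leibniz expansion a fixed point gives the factor ['X], as there are no loops, and a moved
    point gives a constant. By [prod_perm_entries] the constants multiply to the sign of [s], which
    cancels the sign in front; a point moved along a non-arc makes the term zero. *)
Lemma char_poly_perm_sum :
  char_poly A = \sum_(s | moves_along_arcs s) 'X^(n - #|moved s|).
Proof.
rewrite /char_poly /determinant [RHS]big_mkcond /=; apply: eq_bigr => s _.
transitivity ((-1) ^+ s *
    (\prod_i (if s i == i then 'X else 1) *
     (\prod_i (if s i == i then 1 else - A i (s i)))%:P) : {poly int}).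
  congr (_ * _); rewrite rmorph_prod -big_split /=; apply: eq_bigr => i _.
  rewrite !mxE eq_sym; case: eqVneq => [->|_].
    by rewrite (proj2 sidA) subr0 mulr1n mulr1.
  by rewrite mulr0n sub0r mul1r rmorphN.
have -> : \prod_i (if s i == i then 'X else 1) = 'X^(n - #|moved s|) :> {poly int}.
  rewrite -big_mkcond prodr_const; congr ('X^_).
  rewrite -[X in (X - _)%N](card_ord n) -(cardsC (moved s)) addKn -cardsE.
  congr #|pred_of_set _|; apply/setP => i.
  by rewrite !inE negbK.
case: ifP => [sA|/forall_inPn [i]].
  by rewrite prod_perm_entries // rmorphXn rmorphN1 mulrCA -signr_addb addbb mulr1.
rewrite inE /arc negbK => si /eqP A0.
suff -> : \prod_i (if s i == i then 1 else - A i (s i)) = 0 by rewrite !mulr0.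
by apply/eqP/prodf_eq0; exists i => //; rewrite (negbTE si) A0 oppr0.
Qed.

(** * Linear subsidigraphs as permutations *)

Lemma lsd_vertices_arcs_of s : lsd_vertices (arcs_of s) = moved s.
Proof.
apply/setP => v; rewrite !inE; apply/exists_inP/idP.
  case=> -[i j]; rewrite inE /= => /andP [/eqP -> ni] /orP [] /eqP <-.
    by rewrite eq_sym.
  by rewrite (inj_eq perm_inj) eq_sym.
by move=> sv; exists (v, s v); rewrite ?inE /= eqxx // eq_sym.
Qed.

Lemma arcs_of_inj : injective arcs_of.
Proof.
move=> s t /setP st; apply/permP => i.
have [si|si] := eqVneq (s i) i; last first.
  by have := st (i, s i); rewrite !inE /= eqxx eq_sym si /= andbT => /esym/eqP.
have := st (i, t i); rewrite !inE /= eqxx /= si.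
by case: eqVneq => //= ->.
Qed.

Lemma arcs_of_linear s : moves_along_arcs s -> is_linear_subsidigraph A (arcs_of s).
Proof.
move/forall_inP=> sA; apply/andP; split; apply/forall_inP.
  case=> i j; rewrite inE /= => /andP [/eqP -> ni]; apply: sA.
  by rewrite inE eq_sym.
move=> v; rewrite lsd_vertices_arcs_of inE => sv; apply/andP; split; apply/cards1P.
  exists (v, s v); apply/setP => -[i j]; rewrite !inE /= xpair_eqE.
  case: (eqVneq i v) => [->|]; rewrite ?andbF // andbT.
  by case: (eqVneq j (s v)) => //= ->; rewrite eq_sym.
exists ((s^-1)%g v, v); apply/setP => -[i j]; rewrite !inE /= xpair_eqE.
case: (eqVneq j v) => [->|]; rewrite ?andbF // andbT.
have -> : (v == s i) = (i == (s^-1)%g v) by rewrite -(can2_eq (permKV s) (permK s)) eq_sym.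
case: (eqVneq i) => //= ->; apply: contra sv => /eqP vs.
by rewrite -{1}vs permKV.
Qed.

(** The permutation sends the tail of each arc of [X] to its head and fixes all other points.
    Outdegree 1 makes it well defined, indegree 1 makes it injective on tails, and since every head
    is itself a tail, no head collides with a fixed point. *)
Lemma linear_arcs_of X : is_linear_subsidigraph A X ->
  exists2 s, moves_along_arcs s & X = arcs_of s.
Proof.
case/andP=> /forall_inP XA /forall_inP Xv.
have outX p q : p \in X -> q \in X -> p.1 = q.1 -> p = q.
  move=> Xp Xq pq; have vp : p.1 \in lsd_vertices X.
    by rewrite inE; apply/exists_inP; exists p => //; rewrite eqxx.
  have /andP [/cards1P [r /setP Er] _] := Xv _ vp.
  have := Er p; have := Er q; rewrite !inE Xp Xq pq eqxx.
  by move=> /esym/eqP -> /esym/eqP ->.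
have inX p q : p \in X -> q \in X -> p.2 = q.2 -> p = q.
  move=> Xp Xq pq; have vp : p.2 \in lsd_vertices X.
    by rewrite inE; apply/exists_inP; exists p => //; rewrite eqxx orbT.
  have /andP [_ /cards1P [r /setP Er]] := Xv _ vp.
  have := Er p; have := Er q; rewrite !inE Xp Xq pq eqxx.
  by move=> /esym/eqP -> /esym/eqP ->.
have headX p : p \in X -> exists2 q, q \in X & q.1 = p.2.
  move=> Xp; have vp : p.2 \in lsd_vertices X.
    by rewrite inE; apply/exists_inP; exists p => //; rewrite eqxx orbT.
  have /andP [/cards1P [r /setP Er] _] := Xv _ vp.
  by have := Er r; rewrite !inE eqxx => /andP [Xr /eqP rp]; exists r.
pose f v := if [pick p in X | p.1 == v] is Some p then p.2 else v.
have fX p : p \in X -> f p.1 = p.2.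
  move=> Xp; rewrite /f; case: pickP => [q /andP [Xq /eqP qp]|/(_ p)].
    by rewrite (outX q p).
  by rewrite Xp eqxx.
have fP v : (exists2 p, p \in X & p.1 = v /\ p.2 = f v) \/
            (f v = v /\ forall p, p \in X -> p.1 <> v).
  rewrite /f; case: pickP => [q /andP [Xq /eqP qp]|fn]; first by left; exists q.
  by right; split=> // p Xp pv; have := fn p; rewrite Xp pv eqxx.
have f_inj : injective f.
  move=> u v; case: (fP u) => [[p Xp [pu pf]]|[fu nu]];
    case: (fP v) => [[q Xq [qv qf]]|[fv nv]] fuv.
  - by rewrite -pu -qv (inX p q) // pf qf.
  - have [r Xr rp] := headX _ Xp; case: (nv r Xr).
    by rewrite rp pf fuv.
  - have [r Xr rq] := headX _ Xq; case: (nu r Xr).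
    by rewrite rq qf -fuv.
  - by rewrite -fu -fv.
have XE : X = arcs_of (perm f_inj).
  apply/setP => p; rewrite inE permE; apply/idP/andP.
    move=> Xp; rewrite fX // eqxx; split=> //.
    by apply: contraTneq (XA p Xp) => pp; rewrite /arc pp (proj2 sidA) eqxx.
  case=> /eqP pf np; case: (fP p.1) => [[q Xq [qp qf]]|[fp _]].
    suff -> : p = q by [].
    by case: (p) (q) qp qf pf => [a b] [c d] /= -> -> ->.
  by rewrite -fp -pf eqxx in np.
exists (perm f_inj) => //; apply/forall_inP => i.
rewrite inE => si; have := XA (i, perm f_inj i); apply.
by rewrite XE inE eqxx eq_sym.
Qed.

Lemma coef_char_poly_c_lin k : (k <= n)%N -> (char_poly A)`_(n - k) = Posz (c_lin A k).
Proof.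
move=> kn; rewrite char_poly_perm_sum coef_sum.
rewrite (eq_bigr (fun s => (#|moved s| == k)%:R)); last first.
  move=> s _; rewrite coefXn; congr (_%:R); congr nat_of_bool.
  have mn : (#|moved s| <= n)%N by rewrite -[X in (_ <= X)%N]card_ord max_card.
  (* Subtraction on [nat] truncates, so cancelling [n] uses both [kn] and [mn]. *)
  by rewrite eqn_sub2lE // eq_sym.
rewrite -natr_sum -big_mkcondr sum1_card natz; congr Posz.
rewrite /c_lin -(card_imset _ arcs_of_inj); apply: eq_card => X.
rewrite inE; apply/imsetP/andP => [[s]|[/linear_arcs_of [s sA ->]]].
  rewrite unfold_in => /andP [sA sk] ->.
  by rewrite lsd_vertices_arcs_of arcs_of_linear.
by rewrite lsd_vertices_arcs_of => sk; exists s => //; rewrite unfold_in sA.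
Qed.

(** Arcs change colour, so [s] maps the moved points of either colour injectively into those of the
    other. Both colours then occur equally often, and the number of moved points is even. *)
Lemma c_lin_odd k : bipartite_underlying A -> odd k -> c_lin A k = 0%N.
Proof.
case=> col colA ok; apply/eqP; rewrite cards_eq0 -subset0; apply/subsetP => X.
rewrite inE => /andP [/linear_arcs_of [s /forall_inP sA ->]].
rewrite lsd_vertices_arcs_of => /eqP sk.
pose M b := moved s :&: [set i | col i == b].
have leM b : (#|M b| <= #|M (~~ b)|)%N.
  rewrite -(card_imset _ (@perm_inj _ s)); apply: subset_leq_card.
  apply/subsetP => j /imsetP [i /setIP [si]]; rewrite inE => /eqP ib ->.
  have := colA _ _ (sA i si); move: si; rewrite !inE (inj_eq perm_inj) ib => ->.
  by case: (b); case: (col _).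
have := ok; rewrite -sk -(cardsID [set i | col i == true]).
have -> : moved s :\: [set i | col i == true] = M false.
  by apply/setP => i; rewrite !inE andbC; case: (col i).
suff -> : #|M true| = #|M false| by rewrite addnn odd_double.
by apply/eqP; rewrite eqn_leq (leM true) (leM false).
Qed.

Lemma c_lin0 : c_lin A 0 = 1%N.
Proof.
have := coef_char_poly_c_lin (leq0n n); rewrite subn0.
have := char_poly_monic A; rewrite monicE lead_coefE size_char_poly => /eqP -> [].
by [].
Qed.

End Sachs.

(** * One-sided limits *)

Section Analysis.
Local Open Scope R_scope.

Lemma lim_add (f g : R -> R) (a b : R) :
  filterlim f (at_right 0) (locally a) -> filterlim g (at_right 0) (locally b) ->
  filterlim (fun t => f t + g t) (at_right 0) (locally (a + b)).
Proof.
move=> Hf Hg; apply: (filterlim_comp_2 _ _ Rplus Hf Hg).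
exact: (@filterlim_plus R_AbsRing R_NormedModule a b).
Qed.

Lemma lim_mul (f g : R -> R) (a b : R) :
  filterlim f (at_right 0) (locally a) -> filterlim g (at_right 0) (locally b) ->
  filterlim (fun t => f t * g t) (at_right 0) (locally (a * b)).
Proof.
move=> Hf Hg; apply: (filterlim_comp_2 _ _ Rmult Hf Hg).
exact: (@filterlim_mult R_AbsRing a b).
Qed.

Lemma lim_scal (c : R) (f : R -> R) (a : R) :
  filterlim f (at_right 0) (locally a) ->
  filterlim (fun t => c * f t) (at_right 0) (locally (c * a)).
Proof. by apply: lim_mul; apply: filterlim_const. Qed.

Lemma lim_opp (f : R -> R) (a : R) :
  filterlim f (at_right 0) (locally a) -> filterlim (fun t => - f t) (at_right 0) (locally (- a)).
Proof.
move=> Hf; apply: filterlim_comp Hf _.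
exact: (@filterlim_opp R_AbsRing R_NormedModule a).
Qed.

Lemma lim_at_right (h : R -> R) (p : R) :
  ex_derive h p -> filterlim h (at_right p) (locally (h p)).
Proof.
move=> /ex_derive_continuous hc; apply: filterlim_filter_le_1 hc.
exact: filter_le_within.
Qed.

Lemma at_right_gt (p : R) : at_right p (fun t => p < t).
Proof. by exists (mkposreal 1 Rlt_0_1). Qed.

Lemma at_right_E (p : R) (P : R -> Prop) :
  at_right p P <-> exists d, 0 < d /\ forall t, 0 < t < d -> P (p + t).
Proof.
split.
  case=> d Hd; exists d; split; first exact: cond_pos.
  move=> t [t0 td]; apply: Hd; last lra.
  rewrite /ball /= /AbsRing_ball /abs /minus /plus /opp /=.
  have -> : p + t + - p = t by ring.
  by rewrite Rabs_pos_eq; lra.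
case=> d [d0 Hd]; exists (mkposreal d d0) => t td pt.
have {}td : Rabs (t - p) < d := td.
rewrite (_ : t = p + (t - p)); last by rewrite Rplus_minus.
by apply: Hd; rewrite Rabs_pos_eq in td; lra.
Qed.

Lemma lim_mul_ln_0 : filterlim (fun t => t * ln t) (at_right 0) (locally 0).
Proof.
have H : filterlim (fun t => ln (/ t) / (/ t)) (at_right 0) (locally 0).
  apply: (filterlim_comp _ _ _ Rinv (fun y => ln y / y) _ _ _ filterlim_Rinv_0_right).
  exact: is_lim_div_ln_p.
rewrite -{2}Ropp_0; apply: filterlim_ext_loc (lim_opp H).
apply: filter_imp (at_right_gt 0) => t t0.
by rewrite ln_Rinv //; field; lra.
Qed.

Lemma lim_slope_0 (h : R -> R) (l : R) : h 0 = 0 -> is_derive h 0 l ->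
  filterlim (fun t => h t / t) (at_right 0) (locally l).
Proof.
move=> h0 /is_derive_Reals dh; apply/filterlim_locally => eps.
have [d Hd] := dh eps (cond_pos eps).
apply/at_right_E; exists d; split; first exact: cond_pos.
move=> t [t0 td]; have := Hd t; rewrite h0 Rminus_0_r !Rplus_0_l.
by apply; [lra | rewrite Rabs_pos_eq; lra].
Qed.

(** * A primitive for one eigenvalue [x + i y] *)

(** For [z <> 0] this is [z ^ 2] times the squared modulus of [i / z - (x + i y)]. *)
Definition eig_quad (x y z : R) : R := (1 - y * z) ^ 2 + (x * z) ^ 2.

(* At [x = 0] the junk value of [/ Rabs x] is multiplied by [0]. *)
Definition eig_prim (x y z : R) : R :=
  y / 2 * (ln (eig_quad x y z) - ln (z ^ 2)) - ln (eig_quad x y z) / (2 * z)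
  + Rabs x * atan (((x ^ 2 + y ^ 2) * z - y) / Rabs x).

Lemma eig_quad_ge0 x y z : 0 <= eig_quad x y z.
Proof. by apply: Rplus_le_le_0_compat; apply: pow2_ge_0. Qed.

Lemma eig_quad0 x y : eig_quad x y 0 = 1.
Proof. rewrite /eig_quad; ring. Qed.

Lemma eig_quad_eq0 x y z : eig_quad x y z = 0 -> [/\ x = 0, y <> 0, z <> 0 & y * z = 1].
Proof.
rewrite /eig_quad => H.
have h1 : 1 - y * z = 0.
  by have := pow2_ge_0 (1 - y * z); have := pow2_ge_0 (x * z); nra.
have h2 : x * z = 0.
  by have := pow2_ge_0 (1 - y * z); have := pow2_ge_0 (x * z); nra.
have z0 : z <> 0 by move=> z0; rewrite z0 in h1; lra.
have y0 : y <> 0 by move=> y0; rewrite y0 in h1; lra.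
by split=> //; [case: (Rmult_integral _ _ h2) | lra].
Qed.

(** Reflection in [0] conjugates the eigenvalue, so the limits at minus infinity and to the left of
    [0] reduce to those on the right. *)
Lemma eig_prim_opp x y z : eig_prim x y (- z) = - eig_prim x (- y) z.
Proof.
rewrite /eig_prim.
have -> : eig_quad x y (- z) = eig_quad x (- y) z by rewrite /eig_quad; ring.
have -> : (- z) ^ 2 = z ^ 2 by ring.
have -> : ((x ^ 2 + y ^ 2) * - z - y) / Rabs x
  = - (((x ^ 2 + (- y) ^ 2) * z - - y) / Rabs x) by rewrite /Rdiv; ring.
rewrite atan_opp /Rdiv; have -> : / (2 * - z) = - / (2 * z).
  by rewrite -Rinv_opp; congr Rinv; ring.
ring.
Qed.

Lemma eig_quad_abs x y z : eig_quad (Rabs x) y z = eig_quad x y z.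
Proof. by rewrite /eig_quad !Rpow_mult_distr RPow_abs Rabs_pos_eq //; exact: pow2_ge_0. Qed.

Lemma eig_prim_abs x y z : eig_prim (Rabs x) y z = eig_prim x y z.
Proof.
rewrite /eig_prim eig_quad_abs Rabs_Rabsolu; congr (_ + _ * atan ((_ * _ - _) / _)).
by rewrite RPow_abs (Rabs_pos_eq (x ^ 2)) //; exact: pow2_ge_0.
Qed.

Lemma is_derive_eig_prim x y z : z <> 0 -> eig_quad x y z <> 0 ->
  is_derive (eig_prim x y) z (/ z ^ 2 * (ln (eig_quad x y z) / 2)).
Proof.
move=> z0; rewrite -eig_quad_abs => Q0.
apply: (is_derive_ext (eig_prim (Rabs x) y)); first by move=> t; rewrite eig_prim_abs.
have := Rabs_pos x; move: (Rabs x) Q0 => {}x Q0 x0.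
have {Q0} Q0 : 0 < eig_quad x y z by have := eig_quad_ge0 x y z; lra.
have z2 : 0 < z ^ 2 by nra.
(* For a zero real part the arctangent term, with its division by zero, is removed before
   differentiating. *)
case: x0 => x0; last first.
  apply: (is_derive_ext (fun z => y / 2 * (ln (eig_quad 0 y z) - ln (z ^ 2))
      - ln (eig_quad 0 y z) / (2 * z))).
    by move=> t; rewrite /eig_prim -x0 Rabs_R0 Rmult_0_l Rplus_0_r.
  rewrite -x0 /eig_quad in Q0 *.
  have n1 : 1 - y * z <> 0 by move=> n1; rewrite n1 in Q0; lra.
  auto_derive; first by repeat split=> //; move: Q0 z2; simpl; lra.
  rewrite /=; set L := ln _; field; repeat split=> //.
have Q1 : 1 - 2 * y * z + (x ^ 2 + y ^ 2) * z ^ 2 <> 0.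
  by move: Q0; rewrite /eig_quad; nra.
rewrite /eig_prim Rabs_pos_eq; last lra.
rewrite /eig_quad in Q0 *.
auto_derive; first by repeat split=> //; move: Q0 z2; simpl; lra.
rewrite /=; set L := ln _; field; repeat split=> //; try (simpl in *; lra).
have := Rle_0_sqr ((x * x + y * y) * z + - y); rewrite /Rsqr; nra.
Qed.

(** * The primitive at infinity *)

Lemma lim_gt0 (h : R -> R) (a : R) :
  0 < a -> filterlim h (at_right 0) (locally a) -> at_right 0 (fun t => 0 < h t).
Proof. by move=> a0; apply; apply: (open_gt 0). Qed.

(* In [t = / z] all terms are continuous at [0] except [t * ln t]; the arctangent is
   inverted by [atan (/ u) = PI / 2 - atan u]. *)
Lemma lim_eig_prim_infty x y : 0 < x ^ 2 + y ^ 2 ->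
  filterlim (fun t => eig_prim x y (/ t)) (at_right 0)
    (locally (y / 2 * ln (x ^ 2 + y ^ 2) + Rabs x * (PI / 2))).
Proof.
(* For [t <> 0], [q t] is [t ^ 2 * eig_quad x y (/ t)]; it is smooth and nonzero at [t = 0]. *)
move=> r0; pose q t := (t - y) ^ 2 + x ^ 2.
have q0 : q 0 = x ^ 2 + y ^ 2 by rewrite /q; ring.
have qpos : at_right 0 (fun t => 0 < q t).
  by apply: (lim_gt0 (a := q 0)); [rewrite q0 | apply: lim_at_right; rewrite /q; auto_derive].
(* For small [t] this keeps the argument of the arctangent well defined and allows its inversion. *)
have dpos : at_right 0 (fun t => 0 < x ^ 2 + y ^ 2 - y * t).
  apply: (lim_gt0 (a := x ^ 2 + y ^ 2 - y * 0)); first lra.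
  by apply: (lim_at_right (h := fun t => x ^ 2 + y ^ 2 - y * t)); auto_derive.
pose g t := (y / 2 - t / 2) * ln (q t)
  + Rabs x * (PI / 2 - atan (Rabs x * t / (x ^ 2 + y ^ 2 - y * t))).
have lg : filterlim (fun t => g t + t * ln t) (at_right 0)
    (locally (y / 2 * ln (x ^ 2 + y ^ 2) + Rabs x * (PI / 2))).
  have -> : y / 2 * ln (x ^ 2 + y ^ 2) + Rabs x * (PI / 2) = g 0 + 0.
    by rewrite /g q0 Rmult_0_r /Rdiv !Rmult_0_l atan_0; ring.
  apply: lim_add lim_mul_ln_0; apply: lim_at_right; rewrite /g /q.
  by auto_derive; repeat split; rewrite /q in q0; move: q0 r0; simpl; lra.
apply: filterlim_ext_loc lg.
apply: filter_imp (filter_and _ _ (at_right_gt 0) (filter_and _ _ qpos dpos)).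
move=> t [t0 [qt dt]]; rewrite /eig_prim /g.
have -> : eig_quad x y (/ t) = q t * / t ^ 2.
  by rewrite /eig_quad /q; field; lra.
have t2 : 0 < t ^ 2 by nra.
have lt2 : ln (t ^ 2) = 2 * ln t by rewrite /= Rmult_1_r ln_mult //; ring.
rewrite pow_inv ln_mult //; last exact: Rinv_0_lt_compat.
rewrite ln_Rinv // lt2.
suff -> : Rabs x * (PI / 2 - atan (Rabs x * t / (x ^ 2 + y ^ 2 - y * t)))
  = Rabs x * atan (((x ^ 2 + y ^ 2) * / t - y) / Rabs x) by field; lra.
case: (Req_dec x 0) => [->|x0]; first by rewrite Rabs_R0 !Rmult_0_l.
have ax : 0 < Rabs x by exact: Rabs_pos_lt.
rewrite -atan_inv; last first.
  by apply: Rmult_lt_0_compat; [nra | exact: Rinv_0_lt_compat].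
by congr (_ * atan _); field; lra.
Qed.

(** By [eig_prim_opp] the increment is the sum of the values at [/ t] for [y] and [- y]; in the
    limit the logarithms cancel and [PI / 2] is counted twice. The zero eigenvalue is treated apart:
    its quadratic is constantly [1]. *)
Lemma lim_eig_prim_total x y :
  filterlim (fun t => eig_prim x y (/ t) - eig_prim x y (- / t)) (at_right 0)
    (locally (PI * Rabs x)).
Proof.
case: (Req_dec (x ^ 2 + y ^ 2) 0) => r0.
  have x0 : x = 0 by nra.
  have y0 : y = 0 by nra.
  rewrite x0 y0 Rabs_R0 Rmult_0_r.
  apply: (filterlim_ext (fun=> 0)); last exact: filterlim_const.
  move=> t; rewrite eig_prim_opp /eig_prim /eig_quad Ropp_0 !Rmult_0_l Rabs_R0 Rminus_0_r.
  have -> : 1 ^ 2 + 0 ^ 2 = 1 by ring.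
  by rewrite ln_1 /Rdiv; ring.
have rp : 0 < x ^ 2 + y ^ 2 by nra.
have rm : 0 < x ^ 2 + (- y) ^ 2 by nra.
apply: (filterlim_ext (fun t => eig_prim x y (/ t) + eig_prim x (- y) (/ t))).
  by move=> t; rewrite eig_prim_opp; lra.
have -> : PI * Rabs x = y / 2 * ln (x ^ 2 + y ^ 2) + Rabs x * (PI / 2)
   + (- y / 2 * ln (x ^ 2 + (- y) ^ 2) + Rabs x * (PI / 2)).
  have -> : (- y) ^ 2 = y ^ 2 by ring.
  field.
by apply: lim_add; apply: lim_eig_prim_infty.
Qed.

(** * Symmetric jumps of the primitive *)

Lemma lim_sub_self (h : R -> R) (p : R) : ex_derive h p ->
  filterlim (fun e => h (p + e) - h (p - e)) (at_right 0) (locally 0).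
Proof.
move=> hp; have -> : locally 0 = locally (h (p + 0) - h (p - 0)).
  by rewrite Rplus_0_r Rminus_0_r Rminus_diag.
apply: (lim_at_right (h := fun e => h (p + e) - h (p - e))).
by auto_derive; rewrite Rplus_0_r Ropp_0 Rplus_0_r.
Qed.

(** The divergent [ln (e ^ 2)] terms cancel between [y] and [- y]. The quotients [ln Q / (2 e)] tend
    to [- y] and [y], which cancel too, and the two arctangents have opposite values at [0]. *)
Lemma lim_eig_prim_jump0 x y :
  filterlim (fun e => eig_prim x y e - eig_prim x y (- e)) (at_right 0) (locally 0).
Proof.
pose g e := y / 2 * (ln (eig_quad x y e) - ln (eig_quad x (- y) e)) +
  Rabs x * (atan (((x ^ 2 + y ^ 2) * e - y) / Rabs x) +
            atan (((x ^ 2 + y ^ 2) * e + y) / Rabs x)).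
have gp : ex_derive g 0.
  rewrite /g /eig_quad; auto_derive; repeat split; simpl; lra.
have slope w : filterlim (fun e => ln (eig_quad x w e) / e) (at_right 0) (locally (- 2 * w)).
  apply: (lim_slope_0 (h := fun e => ln (eig_quad x w e))).
    by rewrite eig_quad0 ln_1.
  rewrite /eig_quad; auto_derive; first by simpl; lra.
  by rewrite /=; field.
have g0 : g 0 = 0.
  rewrite /g !eig_quad0.
  have -> : ((x ^ 2 + y ^ 2) * 0 - y) / Rabs x = - (((x ^ 2 + y ^ 2) * 0 + y) / Rabs x).
    by rewrite /Rdiv; ring.
  by rewrite atan_opp; ring.
have := lim_add (lim_at_right gp) (lim_scal (c := - / 2)
  (lim_add (slope y) (slope (- y)))).
rewrite g0; have -> : 0 + - / 2 * (-2 * y + -2 * - y) = 0 by ring.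
move=> H; apply: filterlim_ext_loc H; apply: filter_imp (at_right_gt 0) => e e0.
rewrite eig_prim_opp /eig_prim /g.
have -> : (- y) ^ 2 = y ^ 2 by ring.
have -> : (x ^ 2 + y ^ 2) * e - - y = (x ^ 2 + y ^ 2) * e + y by ring.
by field; lra.
Qed.

(** Away from [0] and the zeros of [eig_quad] the primitive is differentiable. At a zero, [x = 0]
    and [p = / y], so the quadratic takes the same value [(y * e) ^ 2] at [p + e] and [p - e]; its
    logarithms differ only in the factor [/ (2 z)]. *)
Lemma lim_eig_prim_jump x y p :
  filterlim (fun e => eig_prim x y (p + e) - eig_prim x y (p - e)) (at_right 0) (locally 0).
Proof.
case: (Req_dec p 0) => [->|p0].
  apply: (filterlim_ext (fun e => eig_prim x y e - eig_prim x y (- e))).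
    by move=> e; rewrite Rplus_0_l Rminus_0_l.
  exact: lim_eig_prim_jump0.
case: (Req_dec (eig_quad x y p) 0) => [/eig_quad_eq0 [x0 y0 _ yp]|Q0]; last first.
  by apply: lim_sub_self; eexists; exact: is_derive_eig_prim.
pose g z := - (y / 2) * ln (z ^ 2).
(* Since [y * p = 1], the difference [/ (p - e) - / (p + e)] equals [k e * e]; the factor [e] turns
   the singular [ln e] into [e * ln e]. *)
pose k e := y / (p + e) + y / (p - e).
have kp : ex_derive (fun e => k e * (ln (Rabs y) * e)) 0.
  by rewrite /k; auto_derive; repeat split; lra.
have kp' : ex_derive k 0 by rewrite /k; auto_derive; repeat split; lra.
have gp : ex_derive g p by rewrite /g; auto_derive; nra.
have := lim_add (lim_sub_self gp) (lim_add (lim_at_right kp) (lim_mul (lim_at_right kp') lim_mul_ln_0)).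
rewrite !Rmult_0_r !Rplus_0_r => H; apply: filterlim_ext_loc H.
have pe : at_right 0 (fun e => 0 < Rabs p - e).
  have ap : 0 < Rabs p by exact: Rabs_pos_lt.
  apply: (lim_gt0 (a := Rabs p - 0)); first lra.
  by apply: (lim_at_right (h := fun e => Rabs p - e)); auto_derive.
apply: filter_imp (filter_and _ _ (at_right_gt 0) pe) => e [e0 {}pe].
have p1 : p + e <> 0 by move: pe; rewrite /Rabs; case: Rcase_abs; lra.
have p2 : p - e <> 0 by move: pe; rewrite /Rabs; case: Rcase_abs; lra.
have ay : 0 < Rabs y by exact: Rabs_pos_lt.
have lnQ s : s ^ 2 = 1 -> ln (eig_quad x y (p + s * e)) = 2 * (ln (Rabs y) + ln e).
  move=> s2; rewrite x0 /eig_quad.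
  have -> : (1 - y * (p + s * e)) ^ 2 + (0 * (p + s * e)) ^ 2 = (Rabs y * e) ^ 2.
    rewrite (Rpow_mult_distr (Rabs y)) RPow_abs (Rabs_pos_eq (y ^ 2)); last exact: pow2_ge_0.
    transitivity (s ^ 2 * (y ^ 2 * e ^ 2)); last by rewrite s2; ring.
    have -> : y * (p + s * e) = 1 + y * s * e by rewrite -yp; ring.
    ring.
  have ye : 0 < Rabs y * e by exact: Rmult_lt_0_compat.
  by rewrite -ln_mult //= Rmult_1_r ln_mult //; ring.
have := lnQ 1; have := lnQ (-1).
rewrite Rmult_1_l (_ : p + -1 * e = p - e); last ring.
rewrite /eig_prim /g /k x0 Rabs_R0 => -> ; last ring.
move=> ->; last ring.
set l := ln (Rabs y); set m := ln e.
have E : y = / p by field_simplify_eq; lra.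
rewrite E; field; lra.
Qed.
(** * Principal values through a primitive *)

Lemma Rltb_lt (x y : R) : Rltb x y -> x < y.
Proof. by rewrite /Rltb; case: Rlt_dec. Qed.

Lemma lt_Rltb (x y : R) : x < y -> Rltb x y.
Proof. by rewrite /Rltb; case: Rlt_dec. Qed.

Lemma path_Rltb_gt (p q : R) (l : seq R) : path Rltb p l -> List.In q l -> p < q.
Proof.
elim: l p => //= r l IH p /andP [/Rltb_lt pr rl] [<- //|ql].
by apply: Rlt_trans pr _; exact: IH ql.
Qed.

Lemma path_Rltb_insert (p q : R) (l : seq R) : path Rltb q l -> q < p ->
  exists l', path Rltb q l' /\ forall z, List.In z l' <-> z = p \/ List.In z l.
Proof.
elim: l q => [|r l IH] q /=.
  by move=> _ qp; exists [:: p]; rewrite /= lt_Rltb //; split=> // z; intuition.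
case/andP=> qr rl qp; case: (Rtotal_order p r) => [pr|[pr|rp]].
- exists [:: p, r & l]; rewrite /= !lt_Rltb // rl; split=> // z; intuition.
- exists (r :: l); rewrite /= qr rl; split=> // z; rewrite pr /=; intuition.
- have [l' [rl' l'E]] := IH r rl rp.
  exists (r :: l'); rewrite /= qr rl'; split=> // z; rewrite l'E; intuition.
Qed.

(** [PV_integral] demands strictly increasing points, while the exceptional points come unordered
    and possibly repeated; only membership has to survive. *)
Lemma sorted_Rltb_exists (l : seq R) :
  exists l', sorted Rltb l' /\ forall z, List.In z l' <-> List.In z l.
Proof.
elim: l => [|p l [l' [sl' l'E]]]; first by exists [::].
suff [m [sm mE]] : exists m, sorted Rltb m /\ forall z, List.In z m <-> z = p \/ List.In z l'.
  by exists m; split=> // z; rewrite mE l'E /=; intuition.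
case: l' sl' {l'E} => [_|q l' ql'].
  by exists [:: p]; split=> // z /=; intuition.
case: (Rtotal_order p q) => [pq|[pq|qp]].
- exists [:: p, q & l']; split; last by move=> z /=; intuition.
  by apply/andP; split; [exact: lt_Rltb |].
- exists (q :: l'); split=> // z; rewrite pq /=; intuition.
- have [m [qm mE]] := path_Rltb_insert ql' qp.
  by exists (q :: m); split=> // z /=; rewrite mE; intuition.
Qed.

Section PrincipalValue.
Variables (f G : R -> R).

Definition jumps (pts : seq R) (e : R) : R :=
  foldr (fun p acc => (G (p + e) - G (p - e)) + acc) 0 pts.

(** The pieces telescope: their increments of [G] add up to the total increment minus the increments
    over the removed gaps. The induction carries the last removed point [q]. *)
Lemma pieces_int_path (q : R) (pts : seq R) : path Rltb q pts ->
  (forall a b, q < a <= b -> (forall z, a <= z <= b -> ~ List.In z pts) ->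
     Rint f a b (G b - G a)) ->
  exists d R0, 0 < d /\ forall e Rb, 0 < e < d -> R0 < Rb ->
    pieces_int f (pv_pieces (q + e) pts e Rb) (G Rb - G (q + e) - jumps pts e).
Proof.
elim: pts q => [|p pts IH] q /=.
  move=> _ fG; exists 1, (q + 1); split; first lra.
  move=> e Rb He HR; exists (G Rb - G (q + e)), 0; split; last by split; [|lra].
  by apply: fG; [lra | move=> z _ []].
case/andP=> /Rltb_lt qp ppts fG.
have [|d [R0 [d0 H]]] := IH p ppts.
  move=> a b ab Hz; apply: fG; first lra.
  by move=> z zab [pz|]; [lra | exact: Hz].
(* Below half the distance from [q] to [p] the two removed neighbourhoods are disjoint. *)
exists (Rmin d ((p - q) / 2)), R0; split; first by apply: Rmin_glb_lt; lra.
move=> e Rb [e0 He] HR.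
have ed := Rmin_l d ((p - q) / 2); have ep := Rmin_r d ((p - q) / 2).
exists (G (p - e) - G (q + e)), (G Rb - G (p + e) - jumps pts e); split.
  apply: fG; first lra.
  by move=> z zab [pz|/(path_Rltb_gt ppts)]; lra.
by split; [apply: H; lra | rewrite /jumps; lra].
Qed.

Lemma pieces_int_sorted (p : R) (pts : seq R) : path Rltb p pts ->
  (forall a b, a <= b -> (forall z, a <= z <= b -> ~ List.In z (p :: pts)) ->
     Rint f a b (G b - G a)) ->
  exists d R0, 0 < d /\ forall e Rb, 0 < e < d -> R0 < Rb ->
    pieces_int f (pv_pieces (- Rb) (p :: pts) e Rb)
      (G Rb - G (- Rb) - jumps (p :: pts) e).
Proof.
move=> ppts fG; have [|d [R0 [d0 H]]] := pieces_int_path ppts.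
  by move=> a b ab Hz; apply: fG; [lra | move=> z zab [pz|]; [lra | exact: Hz]].
exists (Rmin d 1), (Rmax R0 (1 - p)); split; first by apply: Rmin_glb_lt; lra.
move=> e Rb [e0 He] HR.
have ed := Rmin_l d 1; have e1 := Rmin_r d 1.
have R0m := Rmax_l R0 (1 - p); have Rp := Rmax_r R0 (1 - p).
exists (G (p - e) - G (- Rb)), (G Rb - G (p + e) - jumps pts e); split.
  apply: fG; first lra.
  by move=> z zab [pz|/(path_Rltb_gt ppts)]; lra.
by split; [apply: H; lra | rewrite /jumps /=; lra].
Qed.

Lemma PV_integral_primitive (pts : seq R) (L : R) : pts <> [::] ->
  (forall a b, a <= b -> (forall z, a <= z <= b -> ~ List.In z pts) ->
     Rint f a b (G b - G a)) ->
  (forall p, filterlim (fun e => G (p + e) - G (p - e)) (at_right 0) (locally 0)) ->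
  filterlim (fun t => G (/ t) - G (- / t)) (at_right 0) (locally L) ->
  PV_integral f L.
Proof.
move=> pts0 fG Gj GL; have [[|p l] [sl lE]] := sorted_Rltb_exists pts.
  by case: pts pts0 lE {fG} => // p pts _ /(_ p) [_ []]; left.
exists (p :: l); split=> // e e0.
have [||d [R0 [d0 H]]] := @pieces_int_sorted p l; first exact: sl.
  by move=> a b ab Hz; apply: fG => // z zab; rewrite -lE; exact: Hz.
have jl : filterlim (jumps (p :: l)) (at_right 0) (locally 0).
  elim: (p :: l) => [|r m IH]; first exact: filterlim_const.
  rewrite -[X in locally X]Rplus_0_r; exact: lim_add (Gj r) IH.
(* Half of the error goes to the jumps, controlled by [eps], and half to the total increment,
   controlled by [t = / Rb]; hence the threshold [/ d2] for [Rb]. *)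
have e2 : 0 < e / 2 by lra.
move/filterlim_locally: jl => /(_ (mkposreal _ e2)) /at_right_E [d1 [d1p H1]].
move/filterlim_locally: GL => /(_ (mkposreal _ e2)) /at_right_E [d2 [d2p H2]].
exists (Rmin d d1), (Rmax R0 (/ d2)); split; first by apply: Rmin_glb_lt.
move=> eps Rb [eps0 epsd] HR.
have ed := Rmin_l d d1; have ed1 := Rmin_r d d1.
have Rm := Rmax_l R0 (/ d2); have Rd := Rmax_r R0 (/ d2).
exists (G Rb - G (- Rb) - jumps (p :: l) eps); split; first by apply: H; lra.
have {}H1 : Rabs (jumps (p :: l) (0 + eps) - 0) < e / 2 by apply: H1; lra.
have id2 : 0 < / d2 by exact: Rinv_0_lt_compat.
have {}H2 : Rabs (G (/ (0 + / Rb)) - G (- / (0 + / Rb)) - L) < e / 2.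
  apply: H2; split; first by apply: Rinv_0_lt_compat; lra.
  by rewrite -(Rinv_inv d2); apply: Rinv_lt_contravar; [apply: Rmult_lt_0_compat|]; lra.
rewrite !Rplus_0_l Rinv_inv in H1 H2.
by move: H1 H2; rewrite /Rabs; do !case: Rcase_abs; lra.
Qed.

End PrincipalValue.

(** * The logarithmic integral of a product over eigenvalues *)

Definition half_log (zs : seq Cx) (z : R) : R :=
  foldr (fun w acc => ln (eig_quad w.1 w.2 z) / 2 + acc) 0 zs.

Definition prim (zs : seq Cx) (z : R) : R :=
  foldr (fun w acc => eig_prim w.1 w.2 z + acc) 0 zs.

(* Contains spurious points, such as [/ w.2] for [w.1 <> 0]; only the real zeros of
   the quadratics and [0] matter. *)
Definition exceptional (zs : seq Cx) : seq R := 0 :: [seq / w.2 | w <- zs].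

Lemma exceptionalP (zs : seq Cx) (z : R) : ~ List.In z (exceptional zs) ->
  z <> 0 /\ forall w, List.In w zs -> eig_quad w.1 w.2 z <> 0.
Proof.
rewrite /exceptional /= => nz; split; first by move=> z0; apply: nz; left.
move=> w wzs /eig_quad_eq0 [_ y0 z0 yz]; apply: nz; right.
have -> : z = / w.2 by rewrite -(Rmult_1_r (/ w.2)) -yz; field.
exact: (List.in_map (fun w => / w.2)).
Qed.

Lemma is_derive_prim (zs : seq Cx) (z : R) : z <> 0 ->
  (forall w, List.In w zs -> eig_quad w.1 w.2 z <> 0) ->
  is_derive (prim zs) z (/ z ^ 2 * half_log zs z).
Proof.
move=> z0; elim: zs => [|w zs IH] Hw /=.
  by rewrite Rmult_0_r; apply: is_derive_const.
rewrite Rmult_plus_distr_l; apply: (@is_derive_plus _ _ (eig_prim w.1 w.2) (prim zs)).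
  by apply: is_derive_eig_prim => //; apply: Hw; left.
by apply: IH => v vzs; apply: Hw; right.
Qed.

Lemma ex_derive_half_log (zs : seq Cx) (z : R) :
  (forall w, List.In w zs -> eig_quad w.1 w.2 z <> 0) -> ex_derive (half_log zs) z.
Proof.
elim: zs => [|w zs IH] Hw /=; first exact: ex_derive_const.
apply: (@ex_derive_plus _ _ (fun z => ln (eig_quad w.1 w.2 z) / 2) (half_log zs)).
  have Q0 : 0 < eig_quad w.1 w.2 z.
    by have := eig_quad_ge0 w.1 w.2 z; have := Hw w (or_introl erefl); lra.
  by rewrite /eig_quad in Q0 *; auto_derive; move: Q0; simpl; lra.
by apply: IH => v vzs; apply: Hw; right.
Qed.

Lemma Rint_prim (zs : seq Cx) (f : R -> R) (a b : R) :
  (forall z, ~ List.In z (exceptional zs) -> f z = / z ^ 2 * half_log zs z) ->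
  a <= b -> (forall z, a <= z <= b -> ~ List.In z (exceptional zs)) ->
  Rint f a b (prim zs b - prim zs a).
Proof.
move=> fE ab Hz.
have Hf : is_RInt f a b (prim zs b - prim zs a).
  apply: (is_RInt_ext (fun z => / z ^ 2 * half_log zs z)).
    move=> z; rewrite Rmin_left // Rmax_right // => zab.
    by rewrite fE //; apply: Hz; lra.
  apply: is_RInt_derive => z; rewrite Rmin_left // Rmax_right // => /Hz /exceptionalP [z0 Qz].
    exact: is_derive_prim.
  apply: ex_derive_continuous; apply: ex_derive_mult; last exact: ex_derive_half_log.
  by auto_derive; nra.
have pr := ex_RInt_Reals_0 _ _ _ (ex_intro _ _ Hf).
by exists pr; rewrite -RInt_Reals; apply: is_RInt_unique.
Qed.

(** Jumps and total increment are sums over the eigenvalues, so both limits follow by induction,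
    each eigenvalue adding [PI * Rabs w.1]. *)
Lemma PV_integral_half_log (zs : seq Cx) (f : R -> R) :
  (forall z, ~ List.In z (exceptional zs) -> f z = / z ^ 2 * half_log zs z) ->
  PV_integral f (PI * energy zs).
Proof.
move=> fE; apply: (PV_integral_primitive (G := prim zs) (pts := exceptional zs)) => //.
- by move=> a b; apply: Rint_prim.
- move=> p; elim: zs {fE} => [|w zs IH].
    apply: (filterlim_ext (fun=> 0)); last exact: filterlim_const.
    by move=> e /=; rewrite Rminus_0_r.
  rewrite -[X in locally X]Rplus_0_r.
  apply: (filterlim_ext _ _ _ (lim_add (@lim_eig_prim_jump w.1 w.2 p) IH)) => e /=.
  by lra.
- elim: zs {fE} => [|w zs IH].
    apply: (filterlim_ext (fun=> 0)); first by move=> e /=; rewrite Rminus_0_r.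
    by rewrite /= Rmult_0_r; exact: filterlim_const.
  have -> : PI * energy (w :: zs) = PI * Rabs w.1 + PI * energy zs by rewrite /=; ring.
  apply: (filterlim_ext _ _ _ (lim_add (@lim_eig_prim_total w.1 w.2) IH)) => e /=.
  by lra.
Qed.

End Analysis.

(** * Evaluation of the characteristic polynomial on the imaginary axis *)

(** [polyseq] lists coefficients from low to high degree and [c_lin A k] belongs to degree [n - k],
    hence the reversal. *)
Lemma polyseq_phi (n : nat) (A : 'M[int]_n) : is_sidigraph A -> all_cycles_negative A ->
  polyseq (phi A) = rev (mkseq (fun k => Posz (c_lin A k)) n.+1).
Proof.
move=> sA nA; apply: (@eq_from_nth _ 0%R).
  by rewrite size_rev size_mkseq size_char_poly.
move=> i; rewrite size_char_poly => lin.
rewrite nth_rev size_mkseq // subSS nth_mkseq ?ltnS ?leq_subr //.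
by rewrite -coef_char_poly_c_lin ?leq_subr // subKn.
Qed.

Section ImaginaryAxis.
Local Open Scope R_scope.

Definition norm2 (w : Cx) : R := w.1 ^ 2 + w.2 ^ 2.

Lemma norm2_Cmul (u v : Cx) : norm2 (Cmul u v) = norm2 u * norm2 v.
Proof. by rewrite /norm2 /Cmul /=; ring. Qed.

Lemma norm2_prod_eig (zs : seq Cx) (z : R) : z <> 0 ->
  norm2 (foldr (fun v acc => Cmul (Csub (0, / z) v) acc) (RtoC 1) zs) * (z * z) ^ size zs
  = foldr (fun w acc => eig_quad w.1 w.2 z * acc) 1 zs.
Proof.
move=> z0; elim: zs => [|v zs IH] /=; first by rewrite /norm2 /RtoC /=; ring.
rewrite norm2_Cmul -IH; set N := norm2 (foldr _ _ _).
by rewrite /norm2 /Csub /eig_quad /=; field.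
Qed.

Section Horner.
Variables (c : nat -> nat) (z : R).
Hypotheses (z0 : z <> 0) (c0 : c 0 = 1%N) (c_odd : forall k, odd k -> c k = 0%N).

Definition alt_sum (m : nat) : R :=
  1 + List.fold_right Rplus 0
    (List.map (fun j => (-1) ^ j * INR (c (2 * j)%N) * z ^ (2 * j)) (iota 1 m)).

(** Value at [i / z] of the polynomial whose coefficient in degree [m - k] is [c k]; for [c_lin A]
    and [m = n] this is the characteristic polynomial. *)
Definition rev_horner (m : nat) : Cx :=
  foldr (fun a acc => Cadd (RtoC (int_to_R a)) (Cmul (0, / z) acc)) (RtoC 0)
    (rev (mkseq (fun k => Posz (c k)) m.+1)).

Lemma alt_sumS m :
  alt_sum m.+1 = alt_sum m + (-1) ^ m.+1 * INR (c (2 * m.+1)%N) * z ^ (2 * m.+1).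
Proof.
rewrite /alt_sum -(addn1 m) iotaD add1n addn1 /= List.map_app.
elim: (List.map _ (iota 1 m)) => /= [|x l IH]; lra.
Qed.

Lemma rev_hornerS m :
  rev_horner m.+1 = Cadd (RtoC (INR (c m.+1))) (Cmul (0, / z) (rev_horner m)).
Proof. by rewrite /rev_horner mkseqS rev_rcons. Qed.

(* [(i / z) ^ (2 j)] is the real number [(-1) ^ j / z ^ (2 j)]. *)
Lemma rev_horner_even j :
  rev_horner (2 * j) = ((-1) ^ j * (/ z) ^ (2 * j) * alt_sum j, 0).
Proof.
elim: j => [|j IH].
  by rewrite /rev_horner /alt_sum /= c0 /Cadd /Cmul /RtoC /=; congr pair; ring.
(* Two Horner steps lead from [2 * j] to [2 * j + 2]; the coefficient in between has odd index and
   vanishes. *)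
rewrite mulnS !addSn add0n !rev_hornerS IH alt_sumS (c_odd (k := (2 * j).+1)); last first.
  by rewrite /= mul2n odd_double.
have -> : (2 * j.+1 = (2 * j).+2)%N by rewrite mulnS.
rewrite /Cadd /Cmul /RtoC /=; congr pair; last by ring.
have E : (/ z) ^ (2 * j) * z ^ (2 * j) = 1.
  by rewrite -Rpow_mult_distr Rinv_l // pow1.
have E1 : (-1) ^ j * (-1) ^ j = 1 by rewrite -Rpow_mult_distr -[RHS](pow1 j); congr (_ ^ _); ring.
set a := INR _; set p := (/ z) ^ _ in E *; set q := z ^ _ in E *; set s := (-1) ^ _ in E1 *.
transitivity (a * (s * s) * (p * q) - s * p * alt_sum j * / z * / z).
  by rewrite E E1; ring.
by field.
Qed.

(** For even [m] the value is real by [rev_horner_even]. For odd [m] one more multiplication by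
    [i / z] divides the squared modulus by [z * z], which the additional factor [z * z]
    compensates. *)
Lemma norm2_rev_horner m : norm2 (rev_horner m) * (z * z) ^ m = alt_sum m./2 ^ 2.
Proof.
have E k : (/ z) ^ k * z ^ k = 1 by rewrite -Rpow_mult_distr Rinv_l // pow1.
have E1 j : (-1) ^ j * (-1) ^ j = 1.
  by rewrite -Rpow_mult_distr -[RHS](pow1 j); congr (_ ^ _); ring.
have H j : norm2 (rev_horner (2 * j)) * (z * z) ^ (2 * j) = alt_sum j ^ 2.
  rewrite rev_horner_even /norm2 Rpow_mult_distr; move: (2 * j)%N => k.
  transitivity (((-1) ^ j * (-1) ^ j) * ((/ z) ^ k * z ^ k) ^ 2 * alt_sum j ^ 2).
    by rewrite /=; ring.
  by rewrite E E1; ring.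
rewrite -{1 2}(odd_double_half m) -mul2n; case: (odd m); last by rewrite add0n.
rewrite add1n rev_hornerS (c_odd (k := (2 * m./2).+1)); last first.
  by rewrite /= mul2n odd_double.
have -> : Cadd (RtoC (INR 0)) (Cmul (0, / z) (rev_horner (2 * m./2)))
   = Cmul (0, / z) (rev_horner (2 * m./2)).
  by rewrite /Cadd /Cmul /RtoC /=; congr pair; ring.
rewrite norm2_Cmul -H; move: (2 * m./2)%N => k; set N := norm2 (rev_horner _).
by rewrite /norm2 /=; field.
Qed.

End Horner.

Lemma half_log_prod (zs : seq Cx) (z : R) :
  (forall w, List.In w zs -> eig_quad w.1 w.2 z <> 0) ->
  0 < foldr (fun w acc => eig_quad w.1 w.2 z * acc) 1 zs /\
  ln (foldr (fun w acc => eig_quad w.1 w.2 z * acc) 1 zs) = 2 * half_log zs z.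
Proof.
elim: zs => [|w zs IH] Hw /=; first by rewrite ln_1; lra.
have [|pos E] := IH; first by move=> v vzs; apply: Hw; right.
have Q0 : 0 < eig_quad w.1 w.2 z.
  by have := eig_quad_ge0 w.1 w.2 z; have := Hw w (or_introl erefl); lra.
by split; [exact: Rmult_lt_0_compat | rewrite ln_mult // E; field].
Qed.

Lemma ln_Rabs_sq (x : R) : 0 < x ^ 2 -> ln (Rabs x) = / 2 * ln (x ^ 2).
Proof.
move=> x2; have x0 : 0 < Rabs x by apply: Rabs_pos_lt => x0; rewrite x0 in x2; lra.
rewrite -(Rabs_pos_eq (x ^ 2)); last lra.
by rewrite -RPow_abs /= Rmult_1_r ln_mult //; field.
Qed.

(** The square of [alt_sum] and the product of the quadratics both equal [z ^ (2 n)] times the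
    squared modulus of the characteristic polynomial at [i / z]; half the logarithm turns the
    product into a sum. *)
Lemma coulson_integrandE (n : nat) (A : 'M[int]_n) (zs : seq Cx) (z : R) :
  in_Delta2 A -> eigenvalue_list A zs -> ~ List.In z (exceptional zs) ->
  coulson_integrand A z = / z ^ 2 * half_log zs z.
Proof.
move=> [sA [bA nA]] [szs zsE] /exceptionalP [z0 Qz].
have [pos lnE] := half_log_prod Qz.
rewrite /coulson_integrand -/(alt_sum (c_lin A) z n./2); congr Rmult.
have E : alt_sum (c_lin A) z n./2 ^ 2 =
    foldr (fun w acc => eig_quad w.1 w.2 z * acc) 1 zs.
  rewrite -(norm2_rev_horner z0) ?c_lin0 //; last by move=> k; exact: c_lin_odd.
  by rewrite -norm2_prod_eig // szs -zsE /Cpoly_eval polyseq_phi.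
rewrite -E in pos lnE; rewrite ln_Rabs_sq // lnE.
by field.
Qed.

End ImaginaryAxis.

Theorem theorem3p2 (n : nat) (A : 'M[int]_n) (zs : seq Cx) :
  in_Delta2 A -> eigenvalue_list A zs ->
  exists I : R, PV_integral (coulson_integrand A) I /\
                energy zs = Rmult (Rinv PI) I.
Proof.
move=> dA zsA; exists (Rmult PI (energy zs)); split.
  by apply: PV_integral_half_log => z; exact: coulson_integrandE.
by rewrite -Rmult_assoc Rinv_l ?Rmult_1_l //; exact: PI_neq0.
Qed.
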